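(* Let $c\geq1$, $d\geq 0$ be integers, $k$ a constant, and let $\operatorname{ext}\colon\mathbb{N}\to\mathbb{N}$ be a function with the property: for every $(c,d)$-hypergraph $H=(V,E)$, every $\gamma\colon E\to[0,1]$ with $\operatorname{weight}(\gamma)\leq k$ and every well-formed pair $(\mathbf{S},U)$ with $\mathbf{S}\ne\emptyset$ all of whose elements have size at most $c-1$, either $(\mathbf{S},U)$ is perfect or it has an extension of size at most $\operatorname{ext}(n(\mathbf{S},U))$. Then there is a monotone function $\operatorname{sl}\colon\mathbb{N}\to\mathbb{N}$ such that for every such $H,\gamma$ and every sequence of transformations $(\mathbf{S}_1,U_1),\dots,(\mathbf{S}_q,U_q)$ we have $q\leq\operatorname{sl}(n(\mathbf{S}_1,U_1))$.
   Context: A hypergraph $H=(V,E)$ has a finite vertex set $V$ and a set $E$ of non-empty subsets of $V$; it is a $(c,d)$-hypergraph if any $c$ distinct edges have at most $d$ common vertices. For $\gamma\colon E\to[0,1]$: $B(\gamma)=\{v\mid\sum_{e\ni v}\gamma(e)\geq1\}$, $\operatorname{support}(\gamma)=\{e\mid\gamma(e)\neq0\}$, $\operatorname{weight}(\gamma)=\sum_e\gamma(e)$. $\bigcap S$ / $\bigcup S$ denote the vertices in all / some edges of a set $S$ of edges. A pair $(\mathbf{S},U)$ is well-formed if (1) $U\subseteq B(\gamma)$, (2) $\mathbf{S}=\{S_1,\dots,S_r\}$ is a finite collection of sets each of at most $c$ edges, (3) $B(\gamma)\setminus U\subseteq\bigcup_{i}\bigcap S_i$; its size is $n(\mathbf{S},U)=\sum_i|S_i|+2^{|U|}$;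 it is perfect if some $\nu\colon E\to[0,1]$ has $\operatorname{weight}(\nu)\leq k$, $|\operatorname{support}(\nu)|\leq n(\mathbf{S},U)$ and $\bigcup_i\bigcap S_i\cup U\subseteq B(\nu)$. Folding: if some $S^*\in\mathbf{S}$ has $|S^*|=c$, the pair $(\mathbf{S}\setminus\{S^*\},\,U\cup(\bigcap S^*\cap B(\gamma)))$ is a folding. Extension: if $\mathbf{S}\ne\emptyset$ and all elements of $\mathbf{S}$ have size at most $c-1$, for $S\in\mathbf{S}$ and $T\subseteq E$, with $L=(\bigcap S\cap B(\gamma))\setminus\bigcup T$, the pair $((\mathbf{S}\setminus\{S\})\cup\{S\cup\{e\}\mid e\in T\},\,U\cup L)$ is an extension. A transformation of $(\mathbf{S},U)$ is a well-formed pair that is a folding of it or an extension of it of size at most $\operatorname{ext}(n(\mathbf{S},U))$. A sequence of transformations is a sequence of well-formed pairs $(\mathbf{S}_1,U_1),\dots,(\mathbf{S}_q,U_q)$ such that for each $i\in[q-1]$, $(\mathbf{S}_i,U_i)$ is not perfect and $(\mathbf{S}_{i+1},U_{i+1})$ is a transformation of $(\mathbf{S}_i,U_i)$.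
   Formalization: In the definition of extension, T is required to be a subset of E \ S instead of E: if T may meet S, a non-perfect pair can be an extension of itself (e.g. c=2, d=0, k=0, ext=id, S=T={e}), so sequences could be arbitrarily long. *)

(* Defs.v *)
From mathcomp Require Import all_boot all_order all_algebra.
From mathcomp Require Import reals.
Set Implicit Arguments.
Unset Strict Implicit.
Unset Printing Implicit Defensive.
Import Order.TTheory GRing.Theory Num.Theory.

Record hypergraph := Hypergraph {
  vertex : finType;
  edges : {set {set vertex}};
  edges_nonempty : set0 \notin edges }.

(* For S = set0 this is the full vertex set. *)
Definition inter_edges (V : finType) (S : {set {set V}}) : {set V} :=
  \bigcap_(e in S) e.

Definition union_edges (V : finType) (S : {set {set V}}) : {set V} :=
  \bigcup_(e in S) e.

Definition cd_hypergraph (c d : nat) (H : hypergraph) : Prop :=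
  forall S : {set {set vertex H}},
    S \subset edges H -> #|S| = c -> #|inter_edges S| <= d.

Section Pairs.
Variables (R : realType) (H : hypergraph).
Local Notation V := (vertex H).
Local Notation E := (edges H).

(* A function E -> [0,1] is represented by a total function on vertex sets;
   its values outside E are never used. *)
Definition edge_weighting (g : {set V} -> R) : Prop :=
  forall e, e \in E -> (0 <= g e <= 1)%R.

Definition covered (g : {set V} -> R) : {set V} :=
  [set v | (1 <= \sum_(e in E | v \in e) g e)%R].

Definition support (g : {set V} -> R) : {set {set V}} :=
  [set e in E | g e != 0%R].

Definition weight (g : {set V} -> R) : R := (\sum_(e in E) g e)%R.

Definition edge_pair : Type := ({set {set {set V}}} * {set V})%type.

Definition inter_union (SS : {set {set {set V}}}) : {set V} :=
  \bigcup_(S in SS) inter_edges S.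

Definition well_formed (c : nat) (g : {set V} -> R) (p : edge_pair) : Prop :=
  [/\ p.2 \subset covered g,
      forall S, S \in p.1 -> S \subset E /\ #|S| <= c
    & covered g :\: p.2 \subset inter_union p.1].

Definition pair_size (p : edge_pair) : nat :=
  \sum_(S in p.1) #|S| + 2 ^ #|p.2|.

Definition perfect (k : R) (p : edge_pair) : Prop :=
  exists nu : {set V} -> R,
    [/\ edge_weighting nu,
        (weight nu <= k)%R,
        #|support nu| <= pair_size p
      & inter_union p.1 :|: p.2 \subset covered nu].

Definition folding (c : nat) (g : {set V} -> R) (p p' : edge_pair) : Prop :=
  exists S : {set {set V}},
    [/\ S \in p.1, #|S| = c
      & p' = (p.1 :\ S, p.2 :|: (inter_edges S :&: covered g))].

Definition extendable (c : nat) (p : edge_pair) : Prop :=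
  p.1 != set0 /\ forall S, S \in p.1 -> #|S| <= c - 1.

(* The edges of T are taken outside S, so that every e |: S has exactly one edge
   more than S. If T could meet S, then T = [set e] with e \in S would make p an
   extension of itself, and sequences of transformations could be arbitrarily
   long. *)
Definition extension (c : nat) (g : {set V} -> R) (p p' : edge_pair) : Prop :=
  extendable c p /\
  exists S T : {set {set V}},
    [/\ S \in p.1, T \subset E :\: S
      & p' = ((p.1 :\ S) :|: [set e |: S | e in T],
              p.2 :|: ((inter_edges S :&: covered g) :\: union_edges T))].

Definition transformation (c : nat) (ext : nat -> nat) (g : {set V} -> R)
    (p p' : edge_pair) : Prop :=
  well_formed c g p' /\
  (folding c g p p' \/
   (extension c g p p' /\ pair_size p' <= ext (pair_size p))).

Definition transformation_sequence (c : nat) (k : R) (ext : nat -> nat)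
    (g : {set V} -> R) (s : seq edge_pair) : Prop :=
  (forall p, p \in s -> well_formed c g p) /\
  (forall i, i.+1 < size s ->
     ~ perfect k (nth (set0, set0) s i) /\
     transformation c ext g (nth (set0, set0) s i) (nth (set0, set0) s i.+1)).

End Pairs.

Definition extension_bound (R : realType) (c d : nat) (k : R)
    (ext : nat -> nat) : Prop :=
  forall (H : hypergraph) (g : {set vertex H} -> R) (p : edge_pair H),
    cd_hypergraph c d H -> edge_weighting g -> (weight g <= k)%R ->
    well_formed c g p -> extendable c p ->
    perfect k p \/
    exists p', extension c g p p' /\ pair_size p' <= ext (pair_size p).

(* Main.v *)
Require Import Defs.
From mathcomp Require Import all_boot all_order all_algebra.
From mathcomp Require Import reals.

(** Record a pair [(SS, U)] by its profile, the numbers of elements of [SS] of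
    size [0], ..., [c]. A transformation removes one element [S] of [SS] and
    adds only elements larger than [S], so it makes the profile
    lexicographically smaller. Moreover the size after a transformation is
    bounded in terms of the size before it (for a folding, because [c] distinct
    edges have at most [d] common vertices), and every entry of the profile is
    at most the size. A lexicographic descent whose entries are controlled in
    this way splits into blocks of constant first entry: the number of blocks is
    bounded by the initial size, and within a block the remaining entries
    descend, so induction on the number of entries bounds every block in terms
    of the size at its start. *)

Set Implicit Arguments.
Unset Strict Implicit.
Unset Printing Implicit Defensive.

Import Order.TTheory.

Section TupleLexi.
Context {disp : Order.disp_t} {T : porderType disp} {n : nat}.
Implicit Types t u : n.+1.-tuplelexi T.

Lemma ltxi_le_thead t u : (t < u)%O -> (thead t <= thead u)%O.
Proof.
by case/tupleP: t => x t; case/tupleP: u => y u /ltxi_lehead; rewrite !theadE.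
Qed.

Lemma ltxi_behead t u : thead t = thead u -> (t < u)%O ->
  ([tuple of behead t] < [tuple of behead u] :> n.-tuplelexi T)%O.
Proof.
case/tupleP: t => x t; case/tupleP: u => y u; rewrite !theadE => ->.
by rewrite [(_ < _)%O]eqhead_ltxiE.
Qed.

End TupleLexi.

Section ControlledDescent.
Variable f : nat -> nat.
Hypotheses (f_homo : {homo f : m n / m <= n}) (f_ge : forall n, n <= f n).

Lemma leq_iter i j m n : i <= j -> m <= n -> iter i f m <= iter j f n.
Proof.
move=> /subnKC <- le_mn; rewrite iterD.
have: m <= iter (j - i) f n.
  by elim: (j - i) => //= k IHk; apply: leq_trans IHk (f_ge _).
by move: (iter _ f n) => u le_mu; elim: i => //= i; apply: f_homo.
Qed.

(* A block of length at most [L m] that starts at norm [m] leaves the norm of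
   the next block at most [iter (L m) f m]. *)
Definition block_norm (L : nat -> nat) (n i : nat) : nat :=
  iter i (fun m => iter (L m) f m) n.

Lemma block_norm_homo (L : nat -> nat) i :
  {homo L : m n / m <= n} -> {homo block_norm L ^~ i : m n / m <= n}.
Proof.
move=> L_homo m n le_mn; rewrite /block_norm.
by elim: i => //= i IHi; apply: leq_iter => //; apply: L_homo.
Qed.

Lemma sum_block_normS (L : nat -> nat) a n :
  \sum_(i < a.+1) L (block_norm L n i) =
    L n + \sum_(i < a) L (block_norm L (iter (L n) f n) i).
Proof.
rewrite big_ord_recl; congr (_ + _); apply: eq_bigr => i _.
by rewrite /block_norm lift0 iterSr.
Qed.

Fixpoint lex_length (r n : nat) : nat :=
  if r is r'.+1 then
    \sum_(i < n.+1) lex_length r' (block_norm (lex_length r') n i)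
  else 1.

Lemma lex_length_homo r : {homo lex_length r : m n / m <= n}.
Proof.
elim: r => // r IHr m n le_mn /=.
pose F k i := lex_length r (block_norm (lex_length r) k i).
rewrite (big_ord_widen n.+1 (F m)) // big_mkcond; apply: leq_sum => i _.
by case: ifP => // _; apply: (IHr); apply: block_norm_homo.
Qed.

Variables (T : Type) (norm : T -> nat).

Definition controlled_descent r (rank : T -> r.-tuplelexi nat) : rel T :=
  [rel x y | (norm y <= f (norm x)) && (rank y < rank x)%O].

Lemma controlled_descent_norm_last r (rank : T -> r.-tuplelexi nat) x s :
  path (controlled_descent rank) x s ->
  norm (last x s) <= iter (size s) f (norm x).
Proof.
elim: s x => //= y s IHs x /andP[/andP[le_yx _] /IHs le_last].
by apply: leq_trans le_last _; rewrite -iterS iterSr leq_iter.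
Qed.

Definition rank_tail r (rank : T -> r.+1.-tuplelexi nat) x : r.-tuplelexi nat :=
  [tuple of behead (rank x)].

Lemma path_rank_tail r (rank : T -> r.+1.-tuplelexi nat) x s :
  ~~ has (fun y => thead (rank y) != thead (rank x)) s ->
  path (controlled_descent rank) x s ->
  path (controlled_descent (rank_tail rank)) x s.
Proof.
rewrite -all_predC => const_s.
apply: (@sub_in_path _ [pred y | thead (rank y) == thead (rank x)]).
  move=> y z /eqP head_y /eqP head_z /andP[le_zy lt_zy].
  by rewrite /controlled_descent /= le_zy ltxi_behead // head_y.
by rewrite /= eqxx; apply: sub_all const_s => y /negbNE.
Qed.

Lemma controlled_descent_split r (rank : T -> r.+1.-tuplelexi nat) x s :
  path (controlled_descent rank) x s ->
  path (controlled_descent (rank_tail rank)) x s \/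
  exists block y rest,
    [/\ s = block ++ y :: rest,
        path (controlled_descent (rank_tail rank)) x block,
        path (controlled_descent rank) y rest,
        norm y <= iter (size block).+1 f (norm x)
      & thead (rank y) < thead (rank x)].
Proof.
case: (boolP (has (fun y => thead (rank y) != thead (rank x)) s)); last first.
  by move=> const_s path_s; left; apply: path_rank_tail.
case/split_find=> y block rest head_y const_block.
rewrite cat_rcons cat_path => /andP[path_block].
move=> /andP[/andP[le_y lt_y] path_rest].
right; exists block, y, rest; split=> //; first exact: path_rank_tail.
  exact: leq_trans le_y (f_homo (controlled_descent_norm_last path_block)).
rewrite ltn_neqAle head_y /=.
have <- : thead (rank (last x block)) = thead (rank x).
  case/lastP: block const_block {path_block le_y lt_y} => // t z.
  by rewrite has_rcons last_rcons negb_or negbK => /andP[/eqP].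
by rewrite -leEnat ltxi_le_thead.
Qed.

Lemma controlled_descent_size r (rank : T -> r.-tuplelexi nat) x s n :
  (forall y i, tnth (rank y) i <= norm y) ->
  path (controlled_descent rank) x s -> norm x <= n ->
  size (x :: s) <= lex_length r n.
Proof.
elim: r rank x s n => [|r IHr] rank x s n rank_le path_s le_xn.
  case: s path_s => //= y s /andP[/andP[_]].
  by rewrite (tuple0 (rank x)) (tuple0 (rank y)) ltxx.
have tail_le y i : tnth (rank_tail rank y) i <= norm y.
  by rewrite tnth_behead.
suff blocks_le a : thead (rank x) < a ->
    size (x :: s) <= \sum_(i < a) lex_length r (block_norm (lex_length r) n i).
  by apply: blocks_le; rewrite ltnS (leq_trans (rank_le x ord0)).
elim: a x s n path_s le_xn => // a IHa x s n path_s le_xn lt_xa.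
rewrite sum_block_normS.
case: (controlled_descent_split path_s) => [path_tail|].
  by apply: leq_trans (leq_addr _ _); apply: IHr tail_le path_tail le_xn.
case=> block [y [rest [-> path_block path_rest le_y lt_yx]]].
have le_block := IHr _ _ _ _ tail_le path_block le_xn.
rewrite -cat_cons size_cat; apply: leq_add => //; apply: IHa path_rest _ _.
  exact: leq_trans le_y (leq_iter le_block le_xn).
exact: leq_trans lt_yx lt_xa.
Qed.

End ControlledDescent.

Section Profile.
Variable H : hypergraph.
Implicit Types (p q : edge_pair H) (S : {set {set vertex H}}).

Definition size_count p (i : nat) : nat := #|[set S in p.1 | #|S| == i]|.

Definition profile (c : nat) p : c.+1.-tuplelexi nat :=
  [tuple size_count p i | i < c.+1].

(* The summand [2 ^ #|U|] of the size accounts for the empty set of edges. *)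
Lemma card_le_pair_size p : #|p.1| <= pair_size p.
Proof.
rewrite /pair_size (cardsD1 set0) addnC leq_add //; last first.
  by apply: leq_trans (leq_b1 _) _; rewrite expn_gt0.
rewrite -sum1_card [leqRHS](big_setID [set set0]) /=.
apply: leq_trans (leq_addl _ _); apply: leq_sum => S.
by rewrite !inE card_gt0 => /andP[].
Qed.

Lemma tnth_profile_le (c : nat) p i : tnth (profile c p) i <= pair_size p.
Proof.
rewrite tnth_mktuple; apply: leq_trans (card_le_pair_size p).
by apply/subset_leq_card/subsetP => S; rewrite inE => /andP[].
Qed.

Lemma ltxi_profile_replace (c : nat) p S (N : {set {set {set vertex H}}})
    (U : {set vertex H}) :
  S \in p.1 -> #|S| <= c -> (forall S', S' \in N -> #|S| < #|S'|) ->
  (profile c (p.1 :\ S :|: N, U) < profile c p)%O.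
Proof.
move=> Sp; rewrite -ltnS => Sc ltSN.
have countE i : i <= #|S| ->
    size_count (p.1 :\ S :|: N, U) i = #|[set S' in p.1 :\ S | #|S'| == i]|.
  move=> le_iS; apply: eq_card => S'; rewrite !inE.
  case: (boolP (S' \in N)) => [/ltSN lt_SS'|_]; last by rewrite orbF.
  by rewrite gtn_eqF ?andbF //; apply: leq_ltn_trans lt_SS'.
apply/ltxi_tuplePlt; exists (Ordinal Sc) => [i lt_iS|];
  rewrite !tnth_mktuple /=.
  rewrite countE 1?ltnW //; apply: eq_card => S'; rewrite !inE.
  by case: eqP => // ->; rewrite gtn_eqF ?andbF.
rewrite countE // ltEnat /= /size_count [ltnRHS](cardsD1 S) inE Sp eqxx ltnS.
by apply/subset_leq_card/subsetP => S'; rewrite !inE andbA.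
Qed.

End Profile.

Definition size_control (d : nat) (ext : nat -> nat) (n : nat) : nat :=
  maxn (n * 2 ^ d) (\max_(m < n.+1) ext m).

Lemma size_control_homo d ext : {homo size_control d ext : m n / m <= n}.
Proof.
move=> m n le_mn; rewrite geq_max !leq_max leq_mul //=.
apply/orP; right; apply/bigmax_leqP => i _.
exact: (leq_bigmax (widen_ord (le_mn : m.+1 <= n.+1) i)).
Qed.

Lemma size_control_ge d ext n : n <= size_control d ext n.
Proof. by rewrite leq_max leq_pmulr ?expn_gt0. Qed.

Section Transformations.
Variables (R : realType) (H : hypergraph) (c d : nat) (k : R).
Variables (ext : nat -> nat) (g : {set vertex H} -> R).
Implicit Types (p q : edge_pair H) (s : seq (edge_pair H)).
Hypothesis cdH : cd_hypergraph c d H.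

Lemma folding_pair_size p q :
  well_formed c g p -> folding c g p q -> pair_size q <= pair_size p * 2 ^ d.
Proof.
move=> [_ edges_p _] [S [Sp Sc ->]]; rewrite /pair_size /= mulnDl -expnD.
apply: leq_add.
  apply: leq_trans (leq_pmulr _ _); last by rewrite expn_gt0.
  by rewrite [X in _ <= X](big_setD1 S) //= leq_addl.
rewrite leq_pexp2l //; apply: leq_trans (leq_card_setU _ _) _.
rewrite leq_add2l; apply: leq_trans (cdH _ Sc); last by case: (edges_p S Sp).
by rewrite subset_leq_card ?subsetIl.
Qed.

Lemma transformation_pair_size p q :
  well_formed c g p -> transformation c ext g p q ->
  pair_size q <= size_control d ext (pair_size p).
Proof.
move=> wf_p [_ [fold_pq|[_ le_q]]]; rewrite leq_max.
  by rewrite (folding_pair_size wf_p fold_pq).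
apply/orP; right; apply: leq_trans le_q _.
exact: (leq_bigmax (ord_max : 'I_(pair_size p).+1)).
Qed.

Lemma transformation_profile p q :
  well_formed c g p -> transformation c ext g p q ->
  (profile c q < profile c p)%O.
Proof.
move=> [_ edges_p _] [_ [[S [Sp _ ->]]|[[_ [S [T [Sp TE ->]]]] _]]];
  have [_ Sc] := edges_p S Sp.
  by rewrite -[p.1 :\ S]setU0 ltxi_profile_replace // => S'; rewrite inE.
apply: ltxi_profile_replace => // _ /imsetP[e eT ->].
by have := subsetP TE e eT; rewrite cardsU1 inE => /andP[-> _].
Qed.

Lemma transformation_sequence_path p s :
  transformation_sequence c k ext g (p :: s) ->
  path (controlled_descent (size_control d ext) (@pair_size H) (profile c)) p s.
Proof.
case=> wf step; apply/(pathP (set0, set0)) => i lt_is.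
have [_ transf] := step i lt_is.
have wf_i : well_formed c g (nth (set0, set0) (p :: s) i).
  exact/wf/mem_nth/ltnW.
apply/andP; split; first exact: transformation_pair_size.
exact: transformation_profile transf.
Qed.

End Transformations.

Theorem theorem3p13 (R : realType) (c d : nat) (k : R) (ext : nat -> nat)
  (hc : 1 <= c) (hext : extension_bound c d k ext) :
  exists sl : nat -> nat,
    {homo sl : m n / m <= n} /\
    forall (H : hypergraph) (g : {set vertex H} -> R)
           (p : edge_pair H) (s : seq (edge_pair H)),
      cd_hypergraph c d H -> edge_weighting g -> (weight g <= k)%R ->
      transformation_sequence c k ext g (p :: s) ->
      size (p :: s) <= sl (pair_size p).
Proof.
pose f := size_control d ext.
have f_homo : {homo f : m n / m <= n} := size_control_homo d ext.
have f_ge n : n <= f n := size_control_ge d ext n.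
exists (lex_length f c.+1); split=> [|H g p s cdH _ _ seq_ps].
  exact: lex_length_homo.
apply: controlled_descent_size (leqnn _) => //; first exact: tnth_profile_le.
exact: transformation_sequence_path seq_ps.
Qed.
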